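(* The explicit function $\widehat{C} : \mathbb{R} \to \mathbb{R}$ defined in the context is continuous and nowhere constant, and satisfies $\widehat{C}(\mathcal{N}) \cap \mathcal{N} = \emptyset$.
   Context: Nowhere constant: $f:\mathbb{R}\to\mathbb{R}$ is nowhere constant if for every $t_0 \in \mathbb{R}$ and $\varepsilon>0$ there is $t \in (t_0-\varepsilon,t_0+\varepsilon)$ with $f(t) \ne f(t_0)$. Expansions: base-$b$ expansions of reals are made unique by using a finite expansion (only finitely many nonzero digits) whenever possible; for negative $x$ the digits of $|x|$ are used. Normality: for an integer $b\ge2$, $x$ is $b$-normal if every finite word $w$ over $\{0,\dots,b-1\}$ appears with asymptotic frequency $b^{-|w|}$ in the fractional part of the $b$-ary expansion of $x$, where $|w|$ is the length of $w$. $\mathcal{N}$ is the set of real numbers that are $b$-normal for all integers $b\ge 2$. Cantor function $C$: let $x=0.x_1x_2x_3\ldots$ be the ternary expansion of $x\in[0,1)$. Let $m$ be the minimal index with $x_m=1$, and $m=\infty$ if there is none. $C(x)$ is the number with binary digits $y_i = \min\{x_i,1\}$ for $i \le m$ and $y_i=0$ for $i>m$; also $C(1)=1$. Symmetrized version: $C_s(x) := \min\{C(x),1-C(x)\}$. For a (finite or infinite) ternary word $w$, $C_s(w)$ means $C_s(0.w)$, with $0.w$ read in base 3. Definition of $\widehat C$ on $[0,1)$: call a finite ternary word one-stripped if it contains the digit 1 exactly once, as its last digit; $|w|$ denotes the length of $w$. - If the ternary expansion of $x$ contains exactly $m<\infty$ ones, write uniquely $x=0.w_1w_2\ldots w_m\sigma$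 with $w_1,\dots,w_m$ one-stripped and $\sigma$ an infinite word without the digit 1, and set $$\widehat C(x) := \left(\sum_{r=1}^{m} 2^{-r\sum_{k=1}^{r-1}|w_k|}\,C_s(w_r)\right) + 2^{-(m+1)\sum_{k=1}^{m}|w_k|}\,C_s(\sigma)$$ (empty sums are $0$; in particular $\widehat C(x)=C_s(x)$ if $m=0$). - If the ternary expansion of $x$ contains infinitely many ones, write uniquely $x=0.w_1w_2\ldots$ with all $w_i$ one-stripped, and set $$\widehat C(x) := \sum_{r=1}^{\infty} 2^{-r\sum_{k=1}^{r-1}|w_k|}\,C_s(w_r).$$ Set $\widehat C(1)=0$ (note $\widehat C(0)=0$) and extend $\widehat C$ to $\mathbb{R}$ with period $1$. *)

(* Defs.v *)
From HB Require Import structures.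
From mathcomp Require Import all_boot all_order all_algebra.
From mathcomp Require Import finmap.
From mathcomp Require Import all_classical all_reals all_analysis.

Set Implicit Arguments.
Unset Strict Implicit.
Unset Printing Implicit Defensive.

Import Order.TTheory GRing.Theory Num.Theory.
Import numFieldNormedType.Exports.

Local Open Scope classical_set_scope.
Local Open Scope ring_scope.

(* Digits after the radix point, like the words w_r below, are indexed from 0,
   which shifts the exponents in the formulas by one. *)

Section NowhereConstant.
Context {R : realType}.

Definition nowhere_constant (f : R -> R) : Prop :=
  forall t0 eps : R, 0 < eps ->
    exists2 t, t0 - eps < t < t0 + eps & f t <> f t0.

End NowhereConstant.

Section Expansions.
Context {R : realType}.

(* Truncation yields the finite expansion whenever there is one. *)
Definition digit (b : nat) (x : R) (i : nat) : nat :=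
  (Num.truncn (`|x| * b%:R ^+ i.+1) %% b)%N.

Definition occurs_at (d : nat -> nat) (w : seq nat) (i : nat) : bool :=
  [forall j : 'I_(size w), d (i + j)%N == nth 0%N w j].

(* Occurrences are counted by their starting position. *)
Definition occurrences (d : nat -> nat) (w : seq nat) (n : nat) : nat :=
  #|[set i : 'I_n | occurs_at d w i]%SET|.

Definition normal_base (b : nat) (x : R) : Prop :=
  forall w : seq nat, all (fun a => (a < b)%N) w ->
    (occurrences (digit b x) w n)%:R / n%:R @[n --> \oo]
      --> (b%:R ^- size w : R).

Definition normal_numbers : set R :=
  [set x | forall b : nat, (2 <= b)%N -> normal_base b x].

End Expansions.

Section Words.

Definition first_one (d : nat -> nat) : option nat :=
  if pselect (exists i, d i == 1%N) is left h then Some (ex_minn h) else None.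

Definition ones (d : nat -> nat) : set nat := [set i | d i = 1%N].

(* The leading one-stripped word of d and the infinite word that follows it;
   ([::], d) when d has no digit 1. *)
Definition strip (d : nat -> nat) : seq nat * (nat -> nat) :=
  if first_one d is Some m
  then (mkseq d m.+1, fun i => d (m.+1 + i)%N)
  else ([::], d).

Definition rest (d : nat -> nat) (r : nat) : nat -> nat :=
  iter r (fun e => (strip e).2) d.

(* [block d r] is w_(r+1) in the decomposition d = w_1 w_2 ... into one-stripped
   words. *)
Definition block (d : nat -> nat) (r : nat) : seq nat := (strip (rest d r)).1.

Definition blocks_length (d : nat -> nat) (r : nat) : nat :=
  (\sum_(k < r) size (block d k))%N.

End Words.

Section Functions.
Variable R : realType.

Definition cantor_digit (d : nat -> nat) (i : nat) : nat :=
  if first_one d is Some m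
  then if (i <= m)%N then minn (d i) 1 else 0%N
  else minn (d i) 1.

(* Only meaningful on [0, 1]. *)
Definition cantor_fun (x : R) : R :=
  if x == 1 then 1
  else limn (series (fun i => (cantor_digit (digit 3 x) i)%:R / 2 ^+ i.+1 : R)).

Definition cantor_sym (x : R) : R :=
  Num.min (cantor_fun x) (1 - cantor_fun x).

Definition ternary_seq (w : seq nat) : R :=
  \sum_(i < size w) ((nth 0%N w i)%:R / 3 ^+ i.+1).

Definition ternary_stream (d : nat -> nat) : R :=
  limn (series (fun i => (d i)%:R / 3 ^+ i.+1 : R)).

Definition Chat_term (d : nat -> nat) (r : nat) : R :=
  2 ^- (r.+1 * blocks_length d r) * cantor_sym (ternary_seq (block d r)).

Definition Chat_unit (x : R) : R :=
  let d := digit 3 x in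
  if pselect (finite_set (ones d)) then
    let m := #|` fset_set (ones d)|%fset in
    \sum_(r < m) Chat_term d r
      + 2 ^- (m.+1 * blocks_length d m)
        * cantor_sym (ternary_stream (rest d m))
  else limn (series (Chat_term d)).

(* The 1-periodic extension from [0, 1); Chat 1 = Chat 0 = 0. *)
Definition Chat (x : R) : R := Chat_unit (x - (Num.floor x)%:~R).

End Functions.

(* Main.v *)
Require Import Defs.
From HB Require Import structures.
From mathcomp Require Import all_boot all_order all_algebra.
From mathcomp Require Import all_classical all_reals all_analysis.
From mathcomp Require Import finmap ring lra zify.

(** The value at a point is a binary series read off from the ternary digits
    [d_0, d_1, ...]: position [i], in the block number [r.+1] which begins at
    position [L], contributes either 0 or [2 ^- (e_i + 1)], where
    [e_i = r * L + i]. Indeed the minimum of [C] and [1 - C] on a block keeps or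
    complements all the binary digits of [C], according to the first ternary
    digit of the block. This series makes sense for every stream of ternary
    digits ([Chat_stream]), and [Chat_unitE] identifies it with the function on
    the unit interval. Its exponents are strictly increasing
    ([Chat_exponentS]), so the tail from [n] on is at most [2 ^- e_n].

    Continuity. Two streams with a common prefix of length [n] have values at
    distance at most [2 ^- n]. The two ternary expansions of a triadic rational
    have the same value ([Chat_stream_carry]), hence the function oscillates by
    at most [2 ^- n] on every closed triadic interval of length [3 ^- n], and
    these intervals cover the line.

    Nowhere constant. In each triadic interval, with prefix [u], the points
    0.u1 and 0.u11 have different values.

    Normality. If [x] is normal, its fractional part has infinitely many ternary
    digits 1. When the [r]-th of them has just been read, after [n] digits in
    all, the next exponent is [e_n = r.+1 * n]. The first [n] terms of the
    series form a sum of [n] powers of 2, so at most [n.+1] of the first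
    [r.+1 * n] binary digits of the value are 1 ([Chat_stream_few_ones]). As [r]
    grows, the digit 1 fails to have frequency 1/2 in base 2. *)

Set Implicit Arguments.
Unset Strict Implicit.
Unset Printing Implicit Defensive.

Import Order.TTheory GRing.Theory Num.Theory.
Import numFieldNormedType.Exports.

Local Open Scope classical_set_scope.
Local Open Scope ring_scope.

(** * Nested intervals and powers of 1/2 *)
Section NestedIntervals.
Variable R : realType.
Implicit Types u e : nat -> R.

Lemma nested_le u e : (forall n, u n <= u n.+1) ->
    (forall n, u n.+1 + e n.+1 <= u n + e n) ->
  forall n m, (n <= m)%N -> u n <= u m /\ u m + e m <= u n + e n.
Proof.
move=> uS eS n m /subnKC <-; elim: (m - n)%N => [|k [IHu IHe]].
  by rewrite addn0.
by rewrite addnS; split; [exact: le_trans IHu _|exact: le_trans (eS _) IHe].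
Qed.

(** The intervals [u n, u n + e n] decrease, so that [u] converges and each of
    them contains its limit. All the series of digits below are of this form,
    with [e n] the largest possible tail. *)
Lemma nested_lim u e : (forall n, u n <= u n.+1) ->
    (forall n, u n.+1 + e n.+1 <= u n + e n) -> (forall n, 0 <= e n) ->
  cvgn u /\ forall n, u n <= limn u <= u n + e n.
Proof.
move=> uS eS e0; have H := nested_le uS eS.
have u_nd : nondecreasing_seq u by move=> n m /H[].
have uM n m : u m <= u n + e n.
  have [nm|/ltnW mn] := leqP n m.
    by have [_] := H _ _ nm; apply: le_trans; rewrite lerDl.
  by apply: le_trans (u_nd _ _ mn) _; rewrite lerDl.
have cu : cvgn u.
  apply: nondecreasing_is_cvgn => //; exists (u 0%N + e 0%N) => _ [m _ <-].
  exact: uM.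
split=> // n; rewrite nondecreasing_cvgn_le//=.
by apply: limr_le => //; near=> m; exact: uM.
Unshelve. all: by end_near. Qed.

Lemma pow2_split n : 2 ^- n = 2 ^- n.+1 + 2 ^- n.+1 :> R.
Proof. by rewrite exprS invfM; field; rewrite expf_neq0. Qed.

Lemma cvg_pow2 : (fun n => 2 ^- n : R) @ \oo --> (0 : R).
Proof.
rewrite (_ : (fun n => _) = (fun n => (2^-1 : R) ^+ n)); last first.
  by apply/funext => n; rewrite exprVn.
by apply: cvg_expr; rewrite ger0_norm ?invr_ge0// invf_lt1 ?ltr1n.
Qed.

Lemma cvg_pow2_close u y N :
  (forall n, (N <= n)%N -> `|u n - y| <= 2 ^- n) -> u @ \oo --> y.
Proof.
move=> H; apply/cvgrPdist_le => eps eps0.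
have /cvgrPdist_le /(_ eps eps0) := cvg_pow2 => -[M _ HM].
exists (maxn N M) => // n /=; rewrite geq_max => /andP[Nn Mn].
rewrite distrC; apply: le_trans (H _ Nn) _.
have := HM n Mn; rewrite /= sub0r normrN; apply: le_trans.
exact: ler_norm.
Qed.

Lemma pow2_small (eps : R) : 0 < eps -> exists n, 2 ^- n < eps.
Proof.
move=> eps0; have /cvgrPdist_lt /(_ eps eps0) := cvg_pow2 => -[M _ HM].
exists M; have := HM M (leqnn M); rewrite /= sub0r normrN.
by apply: le_lt_trans; exact: ler_norm.
Qed.

End NestedIntervals.

(** * Ternary expansions *)
Section Digits.
Variable R : realType.
Implicit Types (d : nat -> nat) (x : R).

(** Dropping the last [k] digits of a truncation to [n + k] digits leaves the
    truncation to [n] digits. *)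
Lemma truncn_pow_div (b : nat) x n k : (0 < b)%N -> 0 <= x ->
  (Num.truncn (x * b%:R ^+ (n + k)) %/ b ^ k)%N = Num.truncn (x * b%:R ^+ n).
Proof.
move=> b0 x0; set y := x * _ ^+ n.
have y0 : 0 <= y by rewrite mulr_ge0// exprn_ge0.
have bk : 0 < (b%:R ^+ k : R) by rewrite exprn_gt0// ltr0n.
rewrite exprD mulrA -/y.
have /andP[lo hi] := truncn_itv y0.
apply/eqP; rewrite eqn_leq -ltnS ltn_divLR ?expn_gt0 ?b0//.
rewrite leq_divRL ?expn_gt0 ?b0//.
rewrite truncn_lt_nat ?truncn_ge_nat ?mulr_ge0 ?(ltW bk)//.
by rewrite !natrM !natrX ltr_pM2r// ler_pM2r// lo hi.
Qed.

Definition tprefix d n : R := \sum_(i < n) ((d i)%:R / 3 ^+ i.+1).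

Definition ternary d := forall i, (d i < 3)%N.

(** [x] lies in every closed triadic interval cut out by a prefix of [d]:
    unlike [digit 3 x], this allows infinitely many trailing digits 2, so
    that both end points of a triadic interval have an expansion starting with
    its prefix. *)
Definition expands d x := forall n, tprefix d n <= x <= tprefix d n + 3 ^- n.

Lemma pow3_gt0 n : 0 < 3 ^- n :> R.
Proof. by rewrite invr_gt0 exprn_gt0. Qed.

Lemma pow3S n : 3 ^- n = 3 * 3 ^- n.+1 :> R.
Proof. by rewrite exprS invfM; field; rewrite expf_neq0. Qed.

Lemma tprefixS d n : tprefix d n.+1 = tprefix d n + (d n)%:R * 3 ^- n.+1.
Proof. by rewrite /tprefix big_ord_recr. Qed.

Lemma eq_tprefix d d' n : (forall i, (i < n)%N -> d i = d' i) ->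
  tprefix d n = tprefix d' n.
Proof. by move=> H; apply: eq_bigr => i _; rewrite H. Qed.

Lemma tprefix_homo d n : tprefix d n <= tprefix d n.+1.
Proof. by rewrite tprefixS lerDl mulr_ge0// ltW// pow3_gt0. Qed.

Lemma tprefix_nested d n : ternary d ->
  tprefix d n.+1 + 3 ^- n.+1 <= tprefix d n + 3 ^- n.
Proof.
move=> td; rewrite tprefixS (pow3S n).
have : (d n).+1%:R <= 3 :> R by rewrite ler_nat td.
by rewrite -[(d n).+1%:R]natr1; have := pow3_gt0 n.+1; nra.
Qed.

Lemma tprefix_le d n m : ternary d -> (n <= m)%N ->
  tprefix d n <= tprefix d m /\ tprefix d m + 3 ^- m <= tprefix d n + 3 ^- n.
Proof.
move=> td; apply: (nested_le (u := tprefix d) (e := fun n => 3 ^- n)).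
  exact: tprefix_homo.
by move=> k; exact: tprefix_nested.
Qed.

Lemma expands_ternary_stream d : ternary d -> expands d (ternary_stream R d).
Proof.
move=> td n; rewrite /ternary_stream (_ : series _ = tprefix d); last first.
  by apply/funext => k; rewrite /series/= /tprefix big_mkord.
have [||| _ ->//] := @nested_lim R (tprefix d) (fun n => 3 ^- n).
- exact: tprefix_homo.
- by move=> k; exact: tprefix_nested.
- by move=> k; rewrite ltW// pow3_gt0.
Qed.

Lemma expands_ternary_seq (w : seq nat) : ternary (nth 0%N w) ->
  expands (nth 0%N w) (ternary_seq R w).
Proof.
move=> tw n; rewrite (_ : ternary_seq R w = tprefix (nth 0%N w) (size w))//.
set d := nth 0%N w in tw *.
have [nw|/ltnW wn] := leqP n (size w).
  have [-> H] := tprefix_le tw nw.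
  by apply: le_trans H; rewrite lerDl ltW// pow3_gt0.
suff -> : tprefix d (size w) = tprefix d n by rewrite lexx lerDl ltW// pow3_gt0.
rewrite -(subnKC wn) /tprefix big_split_ord/= [X in _ + X]big1 ?addr0// => i _.
by rewrite /d nth_default ?leq_addr// mul0r.
Qed.

(** The integer whose base 3 digits are the first [n] terms of [d]; it locates
    the triadic interval with prefix [d] on the grid of step [3 ^- n]. *)
Fixpoint tprefix_num d n : nat :=
  if n is m.+1 then (3 * tprefix_num d m + d m)%N else 0%N.

Lemma tprefix_numE d n : tprefix d n = (tprefix_num d n)%:R * 3 ^- n.
Proof.
elim: n => [|n IH]; first by rewrite /tprefix big_ord0 mul0r.
by rewrite tprefixS IH /= natrD natrM (pow3S n); ring.
Qed.

Lemma digit3_lt x : ternary (digit 3 x).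
Proof. by move=> i; rewrite /digit ltn_mod. Qed.

(** The half-open triadic intervals of rank [n] are disjoint, so lying in one of
    them determines the first [n] canonical digits. *)
Lemma digit3_eq d x n : ternary d -> tprefix d n <= x < tprefix d n + 3 ^- n ->
  forall i, (i < n)%N -> digit 3 x i = d i.
Proof.
move=> td /andP[lo hi] i ni.
have [le1 le2] := tprefix_le td ni.
have lo' : tprefix d i.+1 <= x by exact: le_trans lo.
have hi' : x < tprefix d i.+1 + 3 ^- i.+1 by exact: lt_le_trans le2.
rewrite tprefix_numE in lo' hi'.
have x0 : 0 <= x.
  by apply: le_trans lo'; rewrite mulr_ge0// ltW// pow3_gt0.
rewrite /digit ger0_norm// (@truncn_def _ _ (tprefix_num d i.+1)); last first.
  have p3 : 0 < 3 ^+ i.+1 :> R by rewrite exprn_gt0.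
  rewrite -ler_pdivrMr// lo' -ltr_pdivlMr//; apply: lt_le_trans hi' _.
  by rewrite -[(tprefix_num d i.+1).+1%:R]natr1 mulrDl mul1r.
by rewrite /= mulnC modnMDl modn_small.
Qed.

Lemma digit3_expands_lt x n : 0 <= x < 1 ->
  tprefix (digit 3 x) n <= x < tprefix (digit 3 x) n + 3 ^- n.
Proof.
move=> /andP[x0 x1].
have -> : tprefix (digit 3 x) n = (Num.truncn (x * 3 ^+ n))%:R * 3 ^- n.
  rewrite tprefix_numE; congr (_%:R * _); elim: n => [|n /= ->].
    by apply/esym/eqP; rewrite truncn_eq ?expr0 ?mulr1 ?x0.
  rewrite /digit ger0_norm// -(@truncn_pow_div 3 x n 1)// addn1 expn1.
  by rewrite mulnC -divn_eq.
have p3 : 0 < 3 ^+ n :> R by rewrite exprn_gt0.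
have /truncn_itv /andP[lo hi] : 0 <= x * 3 ^+ n by rewrite mulr_ge0// ltW.
rewrite ler_pdivrMr// lo/= -[X in _ < _ + X]mul1r -mulrDl ltr_pdivlMr//.
by rewrite natr1.
Qed.

Lemma digit3_expands x : 0 <= x < 1 -> expands (digit 3 x) x.
Proof.
by move=> x01 n; have /andP[-> /ltW ->] := digit3_expands_lt n x01.
Qed.

Lemma expands_01 d x : expands d x -> 0 <= x <= 1.
Proof. by move=> /(_ 0%N); rewrite /tprefix big_ord0 add0r invr1. Qed.

(** Once [x] is the right end point of one of the intervals, it is the right
    end point of all later ones. *)
Lemma expands_tail2 d x n : ternary d -> expands d x ->
  x = tprefix d n + 3 ^- n -> forall i, (n <= i)%N -> d i = 2%N.
Proof.
move=> td ex xn i ni.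
have [_ H1] := tprefix_le td ni.
have H2 := tprefix_nested i td.
have /andP[_ H3] := ex i.+1.
have : (2 : R) <= (d i)%:R.
  rewrite tprefixS (pow3S i) -xn in H1 H2 H3 *.
  by have := pow3_gt0 i.+1; nra.
by rewrite ler_nat => d2; apply/eqP; rewrite eqn_leq d2 andbT -ltnS td.
Qed.

(** An expansion that does not end in 222... never reaches the right end of its
    intervals, and is therefore the canonical one. *)
Lemma expands_canonical d x : ternary d -> expands d x ->
  (forall n, exists2 i, (n <= i)%N & d i != 2%N) ->
  x < 1 /\ digit 3 x = d.
Proof.
move=> td ex nt.
have lt n : x < tprefix d n + 3 ^- n.
  have /andP[_] := ex n; rewrite le_eqVlt => /orP[/eqP xn|//].
  have [i ni /eqP] := nt n; by have := expands_tail2 td ex xn ni.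
split; first by have := lt 0%N; rewrite /tprefix big_ord0 add0r invr1.
apply/funext => i; apply: (@digit3_eq d x i.+1) => //.
by have /andP[-> _] := ex i.+1; rewrite lt.
Qed.

(** If all digits from [n] on were 2, then [x] would be within [3 ^- k] of the
    right end of its interval of rank [n] for every [k], hence equal to it. *)
Lemma digit3_not_tail2 x n : 0 <= x < 1 ->
  exists2 i, (n <= i)%N & digit 3 x i != 2%N.
Proof.
move=> x01; apply: contrapT => H.
have d2 i : (n <= i)%N -> digit 3 x i = 2%N.
  by move=> ni; apply/eqP/negPn/negP => di; apply: H; exists i.
set d := digit 3 x in d2.
have cst k : tprefix d (n + k) + 3 ^- (n + k) = tprefix d n + 3 ^- n.
  elim: k => [|k <-]; first by rewrite addn0.
  by rewrite addnS tprefixS d2 ?leq_addr// (pow3S (n + k)); ring.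
have /andP[_] := digit3_expands_lt n x01; rewrite -/d -subr_gt0.
move=> /pow2_small[k]; rewrite -(cst k).
have /andP[+ _] := digit3_expands_lt (n + k) x01.
rewrite -/d; have : 3 ^- (n + k) <= 2 ^- k :> R.
  rewrite lef_pV2 ?posrE ?exprn_gt0// (@le_trans _ _ (3 ^+ k))//.
    by rewrite lerXn2r// ?nnegrE ?ler_nat.
  by rewrite ler_weXn2l ?leq_addl// ler1n.
lra.
Qed.

End Digits.

(** * The function on ternary streams, as a single binary series *)
Section BlockSeries.
Variable R : realType.
Implicit Types (d : nat -> nat) (x : R).

(** The position following the last digit 1 before [n]: this is where the
    one-stripped block containing position [n] begins. *)
Fixpoint block_start d n : nat :=
  if n is m.+1 then if d m == 1%N then n else block_start d m else 0%N.

Fixpoint ones_before d n : nat :=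
  if n is m.+1 then (ones_before d m + (d m == 1%N))%N else 0%N.

(** The term of index [n] is a multiple of [2 ^- (Chat_exponent d n).+1]. In the
    [r.+1]-st block, which begins at [L], the exponent is [r.+1 * L + (n - L)]:
    the block as a whole is scaled by [2 ^- (r.+1 * L)], and [n - L] is the
    position inside the block. *)
Definition Chat_exponent d n := (ones_before d n * block_start d n + n)%N.

(** The binary digit that position [n] contributes. Taking the minimum of
    [C] and [1 - C] complements the digits of a block exactly when the block
    starts with 2, so a digit 0 or 2 counts if it differs from the first digit
    of its block; a digit 1 closes its block and counts in both cases, since
    the complement of a finite binary fraction ends in the same last 1. *)
Definition Chat_bit d n : bool :=
  (d n == 1%N) || (d n != d (block_start d n)).

Definition Chat_partial d n : R :=
  \sum_(i < n) (Chat_bit d i)%:R * 2 ^- (Chat_exponent d i).+1.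

Definition Chat_stream d : R := limn (Chat_partial d).

Lemma block_startS d n :
  block_start d n.+1 = if d n == 1%N then n.+1 else block_start d n.
Proof. by []. Qed.

Lemma ones_beforeS d n :
  ones_before d n.+1 = (ones_before d n + (d n == 1%N))%N.
Proof. by []. Qed.

Lemma pow2_gt0 n : 0 < 2 ^- n :> R.
Proof. by rewrite invr_gt0 exprn_gt0. Qed.

Lemma pow2_le m n : (m <= n)%N -> 2 ^- n <= 2 ^- m :> R.
Proof.
by move=> mn; rewrite lef_pV2 ?posrE ?exprn_gt0// ler_weXn2l// ler1n.
Qed.

Lemma block_start_le d n : (block_start d n <= n)%N.
Proof. by elim: n => //= n IH; case: ifP => // _; exact: leqW. Qed.

Lemma block_start_not1 d n i : (block_start d n <= i < n)%N -> d i != 1%N.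
Proof.
elim: n => [/andP[]//|n IH /=].
case: ifPn => [_|dn]; first by rewrite ltnS => /andP[/leq_trans H /H];
  rewrite ltnn.
move=> /andP[bi]; rewrite ltnS leq_eqVlt => /orP[/eqP->//|ni].
by apply: IH; rewrite bi.
Qed.

(** Strict monotonicity of the exponents says that the binary digits contributed
    by successive positions never overlap; every estimate on the series rests
    on it. *)
Lemma Chat_exponentS d n : (Chat_exponent d n < Chat_exponent d n.+1)%N.
Proof.
rewrite /Chat_exponent /=; have := block_start_le d n.
by case: ifP => _; nia.
Qed.

Lemma eq_blocks d d' n : (forall i, (i < n)%N -> d i = d' i) ->
  block_start d n = block_start d' n /\ ones_before d n = ones_before d' n.
Proof.
elim: n => //= n IH H; have [i ni|-> ->] := IH; first by apply: H; exact: ltnW.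
by rewrite H.
Qed.

Lemma eq_Chat_exponent d d' n : (forall i, (i < n)%N -> d i = d' i) ->
  Chat_exponent d n = Chat_exponent d' n.
Proof. by move=> /eq_blocks[]; rewrite /Chat_exponent => -> ->. Qed.

Lemma eq_Chat_bit d d' n : (forall i, (i <= n)%N -> d i = d' i) ->
  Chat_bit d n = Chat_bit d' n.
Proof.
move=> H; have [|bs _] := @eq_blocks d d' n; first by move=> i /ltnW; exact: H.
by rewrite /Chat_bit bs !H// block_start_le.
Qed.

Lemma Chat_partialS d n : Chat_partial d n.+1 =
  Chat_partial d n + (Chat_bit d n)%:R * 2 ^- (Chat_exponent d n).+1.
Proof. by rewrite /Chat_partial big_ord_recr. Qed.

Lemma eq_Chat_partial d d' n : (forall i, (i < n)%N -> d i = d' i) ->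
  Chat_partial d n = Chat_partial d' n.
Proof.
move=> H; apply: eq_bigr => i _;
  rewrite (@eq_Chat_bit d d') ?(@eq_Chat_exponent d d')//.
  by move=> j ji; apply: H; exact: ltn_trans ji _.
by move=> j ji; apply: H; exact: leq_ltn_trans ji _.
Qed.

Lemma Chat_partial_homo d n : Chat_partial d n <= Chat_partial d n.+1.
Proof. by rewrite Chat_partialS lerDl mulr_ge0// ltW// pow2_gt0. Qed.

(** The term of index [n] is at most half of [2 ^- Chat_exponent d n], and the
    other half majorizes the next tail. *)
Lemma Chat_partial_nested d n :
  Chat_partial d n.+1 + 2 ^- Chat_exponent d n.+1 <=
  Chat_partial d n + 2 ^- Chat_exponent d n.
Proof.
rewrite Chat_partialS (pow2_split R (Chat_exponent d n)).
have := pow2_le (Chat_exponentS d n); have := pow2_gt0 (Chat_exponent d n).+1.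
by case: (Chat_bit d n); rewrite ?mul1r ?mul0r; lra.
Qed.

Lemma Chat_stream_bounds d n :
  Chat_partial d n <= Chat_stream d <=
  Chat_partial d n + 2 ^- Chat_exponent d n.
Proof.
pose e n : R := 2 ^- Chat_exponent d n.
have [||| _ ->//] := @nested_lim R (Chat_partial d) e.
- exact: Chat_partial_homo.
- exact: Chat_partial_nested.
- by move=> k; rewrite ltW// pow2_gt0.
Qed.

(** A common prefix of length [n] fixes the first [n] terms of the series: this
    is the modulus of continuity for the topology of streams. *)
Lemma Chat_stream_close d d' n : (forall i, (i < n)%N -> d i = d' i) ->
  `|Chat_stream d - Chat_stream d'| <= 2 ^- n.
Proof.
move=> H; have := Chat_stream_bounds d n; have := Chat_stream_bounds d' n.
rewrite (eq_Chat_partial H) (eq_Chat_exponent H).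
have : 2 ^- Chat_exponent d' n <= 2 ^- n :> R by rewrite pow2_le// leq_addl.
rewrite ler_norml => ? /andP[? ?] /andP[? ?]; apply/andP; lra.
Qed.

Lemma cvg_Chat_partial d : Chat_partial d @ \oo --> Chat_stream d.
Proof.
apply: (@cvg_pow2_close _ _ _ 0%N) => n _; have := Chat_stream_bounds d n.
have : 2 ^- Chat_exponent d n <= 2 ^- n :> R by rewrite pow2_le// leq_addl.
rewrite ler_norml => ? /andP[? ?]; apply/andP; lra.
Qed.

Lemma Chat_stream_eq d y N :
  (forall n, (N <= n)%N -> `|Chat_partial d n - y| <= 2 ^- n) ->
    Chat_stream d = y.
Proof. by move=> /cvg_pow2_close/cvg_lim; apply. Qed.

(** After a 1 at position [n], a constant tail 000... or 222... is a block that
    agrees everywhere with its first digit, and contributes nothing. *)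
Lemma Chat_stream_one_tail d n c : c != 1%N -> d n = 1%N ->
  (forall i, (n < i)%N -> d i = c) ->
  Chat_stream d = Chat_partial d n + 2 ^- (Chat_exponent d n).+1.
Proof.
move=> c1 dn dc; apply: (@Chat_stream_eq _ _ n.+1) => m /subnKC <-.
suff -> : Chat_partial d (n.+1 + (m - n.+1)) =
          Chat_partial d n + 2 ^- (Chat_exponent d n).+1.
  by rewrite subrr normr0 ltW// pow2_gt0.
elim: (m - n.+1)%N => [|k IH].
  by rewrite addn0 Chat_partialS /Chat_bit dn mul1r.
rewrite addnS Chat_partialS IH (_ : Chat_bit _ _ = false) ?mul0r ?addr0//.
have bs : block_start d (n.+1 + k) = n.+1.
  elim: k {IH} => [|k IHk]; first by rewrite addn0 block_startS dn.
  by rewrite addnS block_startS dc ?leq_addr// (negbTE c1) IHk.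
by rewrite /Chat_bit bs !dc ?leq_addr// (negbTE c1) eqxx.
Qed.

(** Without a 1 at position [n], positions from [n] on remain in the same block.
    Either position [n] differs from the first digit of the block and the
    following ones agree with it, or the other way round; by the identity
    0.0111... = 0.1000... in base 2, the contribution is the same. *)
Lemma Chat_stream_flip_tail d n c :
  c \in [:: 0%N; 2%N] -> ternary d -> d n = c ->
  (forall i, (n < i)%N -> d i = (2 - c)%N) ->
  Chat_stream d = Chat_partial d n + 2 ^- (Chat_exponent d n).+1.
Proof.
move=> c02 td dn dc.
have [c1 c'1] : (c != 1)%N /\ (2 - c != 1)%N.
  by move: c02; rewrite !inE => /orP[] /eqP->.
have bs k : block_start d (n + k) = block_start d n /\
            ones_before d (n + k) = ones_before d n.
  elim: k => [|k [IH1 IH2]]; first by rewrite addn0.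
  have dk : d (n + k)%N != 1%N.
    case: k {IH1 IH2} => [|k]; first by rewrite addn0 dn.
    by rewrite dc// addnS leq_addr.
  by rewrite addnS block_startS ones_beforeS IH1 IH2 (negbTE dk) addn0.
have ek k : Chat_exponent d (n + k) = (Chat_exponent d n + k)%N.
  by rewrite /Chat_exponent; have [-> ->] := bs k; rewrite addnA.
have bn : Chat_bit d n = (c != d (block_start d n)).
  by rewrite /Chat_bit dn (negbTE c1).
have bk k : Chat_bit d (n.+1 + k) = ((2 - c)%N != d (block_start d n)).
  by rewrite /Chat_bit dc ?leq_addr// (negbTE c'1) addSnnS;
    have [-> _] := bs k.+1.
have bnk k : Chat_bit d (n.+1 + k) = ~~ Chat_bit d n.
  rewrite bk bn; set f := d (block_start d n).
  have f1 : f != 1%N.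
    have [?|] := ltnP (block_start d n) n.
      by apply: (@block_start_not1 d n); rewrite leqnn.
    move=> nb; rewrite /f (_ : block_start d n = n) ?dn//.
    by apply/eqP; rewrite eqn_leq block_start_le nb.
  have f3 : (f < 3)%N by exact: td.
  move: c02; rewrite !inE => /orP[] /eqP-> {bn bk bs};
  by move: f1 f3; clearbody f; move: f => [|[|[|]]].
apply: (@Chat_stream_eq _ _ n.+1) => m /subnKC <-; set k := (m - n.+1)%N.
set e := Chat_exponent d n in ek *.
have -> : Chat_partial d (n.+1 + k) = Chat_partial d n + 2 ^- e.+1
    - (~~ Chat_bit d n)%:R * 2 ^- (e + k).+1.
  elim: k => [|k IH].
    rewrite !addn0 Chat_partialS -/e.
    by case: (Chat_bit d n); rewrite ?mul1r ?mul0r; lra.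
  rewrite addnS Chat_partialS IH bnk addSnnS ek addnS.
  by case: (Chat_bit d n); rewrite ?mul1r ?mul0r;
    have := pow2_split R (e + k).+1; lra.
have := @pow2_le (n.+1 + k) (e + k).+1; rewrite addSn ltnS leq_add2r leq_addl.
move=> /(_ isT); have := pow2_gt0 (e + k).+1.
rewrite ler_norml => ? ?; apply/andP.
by case: (Chat_bit d n); rewrite ?mul1r ?mul0r; lra.
Qed.

End BlockSeries.

(** * Independence of the choice of the expansion *)
Section Carry.
Variable R : realType.
Implicit Types (d : nat -> nat) (x : R).

(** The two expansions v0222... and v1000... (or v1222... and v2000...) of a
    triadic rational: the previous two lemmas evaluate both sides to the same
    number. *)
Lemma Chat_stream_carry d d' n : ternary d -> ternary d' ->
  (forall i, (i < n)%N -> d' i = d i) -> d' n = (d n).+1 ->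
  (forall i, (n < i)%N -> d i = 2%N) -> (forall i, (n < i)%N -> d' i = 0%N) ->
  Chat_stream R d = Chat_stream R d'.
Proof.
move=> td td' dd' dn d2 d'0.
have -> : Chat_stream R d = Chat_partial R d n + 2 ^- (Chat_exponent d n).+1.
  have := td' n; rewrite dn; case dnE: (d n) => [|[|//]] _.
    by apply: (@Chat_stream_flip_tail _ _ _ 0%N).
  by apply: (@Chat_stream_one_tail _ _ _ 2%N).
rewrite -(eq_Chat_partial R dd') -(eq_Chat_exponent dd'); apply/esym.
have := td' n; rewrite dn; case dnE: (d n) dn => [|[|//]] dn _.
  by apply: (@Chat_stream_one_tail _ _ _ 0%N).
by apply: (@Chat_stream_flip_tail _ _ _ 2%N).
Qed.

Lemma Chat_stream_const d c : c != 1%N -> (forall i, d i = c) ->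
  Chat_stream R d = 0.
Proof.
move=> c1 dc; apply: (@Chat_stream_eq _ _ _ 0%N) => n _.
rewrite /Chat_partial big1 ?subrr ?normr0 ?(ltW (pow2_gt0 _ _))// => i _.
by rewrite /Chat_bit !dc (negbTE c1) eqxx mul0r.
Qed.

(** A non-canonical expansion ends in 222... It is turned into the canonical one
    by a carry at the last digit other than 2, except for the expansion 222...
    of 1, on which the series vanishes. *)
Lemma Chat_stream_expands d x : ternary d -> expands d x ->
  Chat_stream R d = if x == 1 then 0 else Chat_stream R (digit 3 x).
Proof.
move=> td ex; have /andP[x0 x1] := expands_01 ex.
have [end_ex|noend] := pselect (exists n, x == tprefix R d n + 3 ^- n);
  last first.
  have xlt n : x < tprefix R d n + 3 ^- n.
    have /andP[_] := ex n; rewrite le_eqVlt => /orP[xn|//].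
    by exfalso; apply: noend; exists n.
  have := xlt 0%N; rewrite /tprefix big_ord0 add0r invr1 => {}x1.
  rewrite lt_eqF//; congr Chat_stream; apply/funext => i.
  apply/esym/(@digit3_eq R d x i.+1) => //.
  by have /andP[-> _] := ex i.+1; rewrite xlt.
have [n /eqP xn nmin] := ex_minnP end_ex.
have d2 := expands_tail2 td ex xn.
case: n xn nmin d2 => [|n] xn nmin d2.
  rewrite xn /tprefix big_ord0 add0r invr1 eqxx.
  by apply: (@Chat_stream_const _ 2%N) => // i; exact: d2.
(* The canonical digits of [x]: d_n 222... becomes (d_n + 1) 000... *)
pose d' i := if (i < n)%N then d i else if i == n then (d n).+1 else 0%N.
have dn2 : (d n < 2)%N.
  have := td n; rewrite ltnS leq_eqVlt => /orP[/eqP dn|//].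
  suff /nmin : x == tprefix R d n + 3 ^- n by rewrite ltnn.
  by rewrite xn tprefixS dn (pow3S R n); apply/eqP; ring.
have td' : ternary d'.
  by move=> i; rewrite /d'; case: ifP => // _; case: ifP.
have xE : x = tprefix R d' n.+1.
  rewrite tprefixS (@eq_tprefix _ d' d); last by move=> i ni; rewrite /d' ni.
  rewrite xn tprefixS /d' ltnn eqxx -[(d n).+1%:R]natr1; ring.
have d'0 k : tprefix R d' (n.+1 + k) = tprefix R d' n.+1.
  elim: k => [|k IH]; first by rewrite addn0.
  rewrite addnS tprefixS IH /d'.
  rewrite (_ : _ < _ = false)%N; last by apply/negbTE; rewrite -leqNgt; lia.
  by rewrite (_ : _ == _ = false) ?mul0r ?addr0//; apply/negbTE; lia.
have ex' : expands d' x.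
  move=> k; rewrite xE; have [nk|/ltnW kn] := leqP n.+1 k.
    by rewrite -(subnKC nk) d'0 lexx lerDl ltW// pow3_gt0.
  have [-> H] := tprefix_le R td' kn.
  by apply: le_trans H; rewrite lerDl ltW// pow3_gt0.
have [|xlt1 ->] := expands_canonical td' ex'.
  move=> k; exists (maxn k n.+1); first exact: leq_maxl.
  by rewrite /d' ltnNge (ltnW (leq_maxr k n.+1))/= (gtn_eqF (leq_maxr k n.+1)).
rewrite lt_eqF//; apply: (@Chat_stream_carry d d' n) => //.
- by move=> i ni; rewrite /d' ni.
- by rewrite /d' ltnn eqxx.
- by move=> i ni; rewrite /d' ltnNge ltnW//= gtn_eqF.
Qed.

End Carry.

(** * The symmetrized Cantor function in terms of digits *)
Section CantorBlocks.
Variable R : realType.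
Implicit Types (d e : nat -> nat) (x : R).

Variant first_one_spec d : option nat -> Type :=
  | FirstOne m of d m = 1%N & (forall i, (i < m)%N -> d i != 1%N) :
      first_one_spec d (Some m)
  | NoOne of (forall i, d i != 1%N) : first_one_spec d None.

Lemma first_oneP d : first_one_spec d (first_one d).
Proof.
rewrite /first_one; case: pselect => [h|h].
  case: (ex_minnP h) => m /eqP dm mmin; constructor=> // i im.
  by apply/negP => /mmin; rewrite leqNgt im.
by constructor=> i; apply/negP => di; apply: h; exists i.
Qed.

Lemma first_one_eq d m : d m = 1%N -> (forall i, (i < m)%N -> d i != 1%N) ->
  first_one d = Some m.
Proof.
move=> dm dlt; case: first_oneP => [k dk klt|H]; last by have := H m;
  rewrite dm.
by case: (ltngtP k m) => [/dlt|/klt|->//]; rewrite ?dk ?dm.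
Qed.

Lemma blocks_before_first_one e n : (forall i, (i < n)%N -> e i != 1%N) ->
  block_start e n = 0%N /\ ones_before e n = 0%N.
Proof.
elim: n => // n IH H; rewrite block_startS ones_beforeS (negbTE (H n _))//.
by have [|-> ->] := IH; first by move=> i /ltnW; exact: H.
Qed.

Definition cantor_part e n : R :=
  \sum_(i < n) (cantor_digit e i)%:R / 2 ^+ i.+1.

Lemma cantor_partS e n : cantor_part e n.+1 =
  cantor_part e n + (cantor_digit e n)%:R * 2 ^- n.+1.
Proof. by rewrite /cantor_part big_ord_recr. Qed.

Lemma cantor_digit_le1 e i : (cantor_digit e i <= 1)%N.
Proof.
rewrite /cantor_digit; case: first_one => [m|]; last exact: geq_minr.
by case: ifP => // _; exact: geq_minr.
Qed.

Lemma cantor_part_bounds e n :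
  cantor_part e n <= limn (cantor_part e) <= cantor_part e n + 2 ^- n.
Proof.
have [||| _ ->//] := @nested_lim R (cantor_part e) (fun n => 2 ^- n) => {}n.
- by rewrite cantor_partS lerDl mulr_ge0// ltW// pow2_gt0.
- rewrite cantor_partS; have : (cantor_digit e n)%:R <= 1 :> R.
    by rewrite lern1 cantor_digit_le1.
  by have := pow2_split R n; have := pow2_gt0 R n.+1; nra.
- by rewrite ltW// pow2_gt0.
Qed.

Lemma cantor_digit_before e i : (forall j, (j < i)%N -> e j != 1%N) ->
  cantor_digit e i = minn (e i) 1.
Proof.
rewrite /cantor_digit => ne; case: first_oneP => // m em _.
by case: leqP => // /ne; rewrite em.
Qed.

Lemma cantor_funE x : x < 1 -> cantor_fun x = limn (cantor_part (digit 3 x)).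
Proof.
move=> x1; rewrite /cantor_fun lt_eqF//; congr (limn _).
by apply/funext => n; rewrite /series/= big_mkord.
Qed.

Lemma cantor_part_stop e m n : first_one e = Some m -> (m < n)%N ->
  cantor_part e n = cantor_part e m.+1.
Proof.
move=> em /subnKC <-; elim: (n - m.+1)%N => [|k IH]; first by rewrite addn0.
rewrite addnS cantor_partS IH /cantor_digit em ifF ?mul0r ?addr0//.
by apply/negbTE; rewrite -ltnNge addSn ltnS leq_addr.
Qed.

Lemma lim_cantor_part e m : first_one e = Some m ->
  limn (cantor_part e) = cantor_part e m.+1.
Proof.
move=> em; apply/cvg_lim => //; apply: (@cvg_pow2_close _ _ _ m.+1) => n mn.
by rewrite (cantor_part_stop em mn) subrr normr0 ltW// pow2_gt0.
Qed.

(** Up to the first 1 included, a block that starts with 0 has the digits of the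
    Cantor function. *)
Lemma cantor_part0 e n : ternary e -> e 0%N = 0%N ->
  (forall i, (i.+1 < n)%N -> e i != 1%N) ->
    Chat_partial R e n = cantor_part e n.
Proof.
move=> te e0 ne; apply: eq_bigr => i _.
have nei j : (j < i)%N -> e j != 1%N.
  by move=> ji; apply: ne; apply: leq_ltn_trans ji _.
have [bs ob] := blocks_before_first_one nei.
rewrite /Chat_exponent bs ob mul0n add0n; congr (_%:R / _).
rewrite cantor_digit_before// /Chat_bit bs e0.
by have := te i; case: (e i) => [|[|[]]].
Qed.

(** Before the first 1, a block that starts with 2 has the complements of the
    digits of the Cantor function. *)
Lemma cantor_part2 e n : ternary e -> e 0%N = 2%N ->
  (forall i, (i < n)%N -> e i != 1%N) ->
  Chat_partial R e n + cantor_part e n = 1 - 2 ^- n.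
Proof.
move=> te e0; elim: n => [|n IH] ne.
  by rewrite /Chat_partial /cantor_part !big_ord0 expr0; field.
have ne' i : (i < n)%N -> e i != 1%N by move=> /ltnW; exact: ne.
have [bs ob] := blocks_before_first_one ne'.
rewrite Chat_partialS cantor_partS addrACA IH//.
rewrite /Chat_exponent bs ob mul0n add0n.
rewrite -mulrDl -natrD (_ : (_ + _)%N = 1%N);
  first by have := pow2_split R n; lra.
rewrite cantor_digit_before// /Chat_bit bs e0.
by have := te n; have := ne n; rewrite ltnSn;
  case: (e n) => [|[|[]]]// /(_ isT).
Qed.

(** The first ternary digit decides on which side of 1/2 the Cantor function is,
    hence which of the two branches realizes the minimum. *)
Lemma cantor_sym_digits x : 0 <= x < 1 ->
  cantor_sym x = let e := digit 3 x in
    if first_one e is Some m then Chat_partial R e m.+1 else Chat_stream R e.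
Proof.
move=> /andP[x0 x1] /=; rewrite /cantor_sym cantor_funE//.
have := digit3_lt x; set e := digit 3 x => te.
have cb := cantor_part_bounds e.
have C1 : cantor_part e 1 = (minn (e 0%N) 1)%:R / 2.
  rewrite /cantor_part big_ord1 expr1 /cantor_digit; congr (_%:R / _).
  by case: first_one.
have := cb 1%N; rewrite C1 expr1.
case e0 : (e 0%N) (te 0%N) => [|[|[|//]]] _ cb1.
- have -> : Num.min (limn (cantor_part e)) (1 - limn (cantor_part e)) =
      limn (cantor_part e).
    by apply/min_idPl; move: cb1; rewrite /minn/= => /andP[]; lra.
  case: first_oneP (@lim_cantor_part e) => [m em mlt /(_ m erefl) ->|ne _].
    exact/esym/cantor_part0.
  by congr (limn _); apply/funext => n; apply/esym/cantor_part0.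
- have eS : first_one e = Some 0%N by apply: first_one_eq.
  rewrite eS (lim_cantor_part eS) C1 e0 /Chat_partial big_ord1 /Chat_bit e0/=.
  rewrite /Chat_exponent/= /minn/= mul1r.
  by rewrite -[_ ^- 1]/(2^-1) /Num.min; case: ltP; lra.
- have -> : Num.min (limn (cantor_part e)) (1 - limn (cantor_part e)) =
      1 - limn (cantor_part e).
    by apply/min_idPr; move: cb1; rewrite /minn/= => /andP[]; lra.
  case: first_oneP (@lim_cantor_part e) => [m em mlt /(_ m erefl) ->|ne _].
    have := cantor_part2 te e0 mlt; have [bs ob] := blocks_before_first_one mlt.
    rewrite cantor_partS Chat_partialS /Chat_bit em/=.
    rewrite /Chat_exponent bs ob mul0n add0n.
    rewrite /cantor_digit (first_one_eq em mlt) leqnn em /minn/= !mul1r.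
    by have := pow2_split R m; lra.
  apply/esym/(@Chat_stream_eq _ _ _ 0%N) => n _.
  have := @cantor_part2 e n te e0 (fun i _ => ne i).
  have := cb n; have := pow2_gt0 R n.
  rewrite ler_norml => ? /andP[? ?] ?; apply/andP; lra.
Qed.

End CantorBlocks.

(** * The digitwise series computes the function *)
Section Chat.
Variable R : realType.
Implicit Types (d e : nat -> nat) (x : R).

(** A one-stripped word followed by zeros is a canonical expansion. *)
Lemma cantor_sym_block e m : ternary e -> e m = 1%N ->
    (forall i, (i < m)%N -> e i != 1%N) ->
  cantor_sym (ternary_seq R (mkseq e m.+1)) = Chat_partial R e m.+1.
Proof.
move=> te em mlt; set w := mkseq e m.+1; pose d := nth 0%N w.
have dE i : (i < m.+1)%N -> d i = e i by move=> im; rewrite /d nth_mkseq.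
have d0 i : (m < i)%N -> d i = 0%N.
  by move=> mi; rewrite /d nth_default// size_mkseq.
have td : ternary d.
  by move=> i; have [/dE->|/d0->//] := ltnP i m.+1; exact: te.
have ex := expands_ternary_seq R td.
have [n|x1 dx] := expands_canonical td ex.
  by exists (maxn n m.+1); rewrite ?leq_maxl ?d0 ?leq_maxr.
have /andP[x0 _] := expands_01 ex.
have d1 : first_one d = Some m.
  apply: first_one_eq; first by rewrite dE.
  by move=> i im; rewrite dE ?mlt// ltnW.
rewrite cantor_sym_digits ?x0//= dx d1.
by apply: eq_Chat_partial.
Qed.

Lemma cantor_sym_stream e : ternary e ->
    (forall n, exists2 i, (n <= i)%N & e i != 2%N) -> (forall i, e i != 1%N) ->
  cantor_sym (ternary_stream R e) = Chat_stream R e.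
Proof.
move=> te e2 e1; have ex := expands_ternary_stream R te.
have [x1 dx] := expands_canonical te ex e2; have /andP[x0 _] := expands_01 ex.
rewrite cantor_sym_digits ?x0//= dx.
by case: first_oneP => // m em; have := e1 m; rewrite em.
Qed.

Lemma blocks_lengthS d r :
  blocks_length d r.+1 = (blocks_length d r + size (block d r))%N.
Proof. by rewrite /blocks_length big_ord_recr. Qed.

Lemma blocks_length_ge d r : (forall k, first_one (rest d k) <> None) ->
  (r <= blocks_length d r)%N.
Proof.
move=> H; elim: r => // r IH; rewrite blocks_lengthS.
apply: leq_ltn_trans IH _; rewrite -[ltnLHS]addn0 ltn_add2l /block /strip.
by case: first_one (H r) => // m _; rewrite size_mkseq.
Qed.

Lemma rest_shift d r : rest d r = fun i => d (blocks_length d r + i)%N.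
Proof.
elim: r => [|r IH]; apply/funext => i; first by rewrite /blocks_length big_ord0.
rewrite blocks_lengthS [rest d r.+1]iterS -/(rest d r) /block /strip.
case: first_one => [m|]; last by rewrite addn0 IH.
by rewrite size_mkseq /= IH addnA.
Qed.

(** The block series restarts, up to a scaling, after each digit 1. *)
Lemma Chat_partial_shift d n r j : block_start d n = n -> ones_before d n = r ->
    (forall i, (i.+1 < j)%N -> d (n + i)%N != 1%N) ->
  Chat_partial R d (n + j) = Chat_partial R d n +
    2 ^- (r.+1 * n) * Chat_partial R (fun i => d (n + i)%N) j.
Proof.
move=> bn on; elim: j => [|j IH] H.
  by rewrite addn0 {3}/Chat_partial big_ord0 mulr0 addr0.
rewrite addnS !Chat_partialS IH => [|i ij]; last by apply: H; exact: ltnW.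
have {}H i : (i < j)%N -> d (n + i)%N != 1%N by move=> ij; apply: H.
have [bs ob] := blocks_before_first_one H.
have [bs' ob'] : block_start d (n + j) = n /\ ones_before d (n + j) = r.
  elim: j H {IH bs ob} => [|j IH] H; first by rewrite addn0.
  rewrite addnS block_startS ones_beforeS (negbTE (H j _))//.
  by have [|-> ->] := IH; [move=> i /ltnW; exact: H|rewrite addn0].
rewrite mulrDr addrA; congr (_ + _).
rewrite /Chat_bit bs bs' addn0 mulrCA -invfM -exprD; congr (_ * _^-1);
  congr (_ ^+ _).
rewrite /Chat_exponent bs ob bs' ob'; ring.
Qed.

(** Adding the series block by block: each one-stripped block contributes one
    term of the sum defining the function. *)
Lemma blocks_start d r : ternary d ->
    (forall k, (k < r)%N -> first_one (rest d k) <> None) ->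
  [/\ block_start d (blocks_length d r) = blocks_length d r,
      ones_before d (blocks_length d r) = r
    & Chat_partial R d (blocks_length d r) = \sum_(k < r) Chat_term R d k].
Proof.
move=> td; elim: r => [|r IH] H.
  by rewrite /blocks_length !big_ord0; split => //;
    rewrite /Chat_partial big_ord0.
have [|bs ob sumE] := IH; first by move=> k /ltnW; exact: H.
have := H r (ltnSn r); set e := rest d r.
have eE i : e i = d (blocks_length d r + i)%N by rewrite /e rest_shift.
have te : ternary e by move=> i; rewrite eE.
case eS : {1}(first_one e) => [m|//] _.
case: first_oneP eS => // m' em mlt [mm']; subst m'.
have bE : block d r = mkseq e m.+1.
  by rewrite /block -/e /strip (first_one_eq em mlt).
rewrite blocks_lengthS bE size_mkseq big_ord_recr/= -sumE /Chat_term bE.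
rewrite (cantor_sym_block te em mlt).
rewrite (Chat_partial_shift bs ob) => [|i]; last by rewrite -eE; exact: mlt.
rewrite (_ : (fun i => d (blocks_length d r + i)%N) = e); last exact/funext.
rewrite addnS block_startS ones_beforeS -eE em eqxx; split => //.
rewrite addn1; congr _.+1.
elim: m mlt {em bE} => [|m IHm] mlt; first by rewrite addn0.
by rewrite addnS ones_beforeS -eE (negbTE (mlt m _))// addn0 IHm// => i /ltnW;
  exact: mlt.
Qed.

(** Identifies the number [m] of digits 1 in the definition with the number of
    blocks that have been stripped. *)
Lemma card_ones d n : (forall i, (n <= i)%N -> d i != 1%N) ->
  #|` fset_set (ones d)|%fset = ones_before d n.
Proof.
move=> H; have -> : ones d = [set` [fset i in
  [seq i <- iota 0 n | d i == 1%N]]%fset].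
  apply/seteqP; split=> i; rewrite /ones /= !inE mem_filter mem_iota/= add0n.
    move=> di; rewrite di eqxx/= ltnNge; apply/negP => /H.
    by rewrite di.
  by move=> /andP[/eqP].
rewrite set_fsetK card_fseq undup_id ?filter_uniq ?iota_uniq//.
rewrite size_filter; elim: n {H} => // n IH.
by rewrite -[n.+1]addn1 iotaD count_cat IH add0n/= addn0 addn1 ones_beforeS.
Qed.

(** With finitely many digits 1, the sum stops at the first remainder that
    contains no 1, and the rest of the series is the contribution of that
    remainder; otherwise the partial sums of [Chat_term] are a subsequence of
    those of the series. *)
Lemma Chat_unitE x : 0 <= x < 1 -> Chat_unit x = Chat_stream R (digit 3 x).
Proof.
move=> x01; rewrite /Chat_unit; have td := digit3_lt x.
have nt n := digit3_not_tail2 n x01; set d := digit 3 x in td nt *.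
case: pselect => [fin|inf].
  have [N ltN] : exists N, forall i, (N <= i)%N -> d i != 1%N.
    exists (\max_(i <- fset_set (ones d)) i).+1 => i;
      apply: contraTN => /eqP di.
    rewrite -ltnNge ltnS; apply: leq_bigmax_seq => //.
    by rewrite in_fset_set//; apply/mem_set.
  have stop : exists r, first_one (rest d r) == None.
    apply/not_existsP => H.
    have {}H k : first_one (rest d k) <> None by move=> /eqP; exact: H.
    have lenN := blocks_length_ge N H.
    have := H N; case: first_oneP => // m; rewrite rest_shift => dm _ _.
    by have := ltN _ (leq_trans lenN (leq_addr m _)); rewrite dm.
  have [r /eqP rstop rmin] := ex_minnP stop.
  have [k kr H|bs ob sumE] := @blocks_start d r td.
    by have := rmin k; rewrite H => /(_ erefl); rewrite leqNgt kr.
  have e1 : forall i, rest d r i != 1%N by case: first_oneP rstop.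
  have -> : #|` fset_set (ones d)|%fset = r.
    rewrite (@card_ones _ (blocks_length d r)) => [//|i /subnKC <-].
    by have := e1 (i - blocks_length d r)%N; rewrite rest_shift.
  have te : ternary (rest d r) by move=> i; rewrite rest_shift.
  rewrite cantor_sym_stream//; last first.
    move=> n; have [i ni di] := nt (blocks_length d r + n)%N.
    exists (i - blocks_length d r)%N;
      first by rewrite leq_subRL// (leq_trans _ ni)// leq_addr.
    by rewrite rest_shift subnKC// (leq_trans _ ni)// leq_addr.
  rewrite -sumE; apply/esym/cvg_lim => //.
  rewrite -(cvg_shiftn (blocks_length d r)).
  rewrite (_ : (fun n => _) = fun n => Chat_partial R d (blocks_length d r) +
      2 ^- (r.+1 * blocks_length d r) * Chat_partial R (rest d r) n);
        last first.
    apply/funext => n; rewrite addnC (Chat_partial_shift bs ob).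
      by rewrite -rest_shift.
    by move=> i _; have := e1 i; rewrite rest_shift.
  apply: cvgD; first exact: cvg_cst.
  by apply: cvgMr; exact: cvg_Chat_partial.
have nostop r : first_one (rest d r) <> None.
  case: first_oneP => // e1 _; apply: inf.
  apply: (@sub_finite_set _ _ `I_(blocks_length d r)) => [i di|];
    last exact: finite_II.
  rewrite /= ltnNge; apply/negP => ri.
  by have := e1 (i - blocks_length d r)%N; rewrite rest_shift subnKC// di.
apply/cvg_lim => //.
apply: (@cvg_pow2_close _ _ _ 0%N) => r _.
have [//|_ _] := @blocks_start d r td; rewrite /series/= big_mkord => <-.
have := Chat_stream_bounds R d (blocks_length d r).
have : 2 ^- Chat_exponent d (blocks_length d r) <= 2 ^- r :> R.
  exact/pow2_le/(leq_trans (blocks_length_ge r nostop) (leq_addl _ _)).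
rewrite ler_norml => ? /andP[? ?]; apply/andP; lra.
Qed.

End Chat.

(** * Continuity and absence of intervals of constancy *)
Section Continuity.
Variable R : realType.
Implicit Types (d u : nat -> nat) (x s t z : R).

(** Any integer translate of [x] into the closed unit interval, with any ternary
    expansion, may be used: the end point 1 is allowed because the stream
    222... is sent to 0. *)
Lemma Chat_expands d x (k : int) : ternary d -> expands d (x - k%:~R) ->
  Chat x = Chat_stream R d.
Proof.
move=> td ex; have /andP[y0 y1] := expands_01 ex.
rewrite (Chat_stream_expands td ex) /Chat; case: eqP => [y|/eqP y].
  have -> : Num.floor x = (k + 1)%R.
    apply: floor_def; rewrite !rmorphD/=; apply/andP; split; lra.
  rewrite Chat_unitE; last by rewrite rmorphD/=; apply/andP; split; lra.
  apply: (@Chat_stream_const _ _ 0%N) => // i; rewrite /digit.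
  by rewrite rmorphD/= opprD addrA y subrr normr0 mul0r truncn0.
have y1' : x - k%:~R < 1 by rewrite lt_neqAle y.
have -> : Num.floor x = k.
  by apply: floor_def; rewrite !rmorphD/=; apply/andP; split; lra.
by rewrite Chat_unitE ?y0.
Qed.

(** All points of a closed triadic interval have an expansion starting with its
    prefix; for the right end point it ends in 222... *)
Lemma expands_in_cylinder u n z : ternary u ->
    tprefix R u n <= z <= tprefix R u n + 3 ^- n ->
  exists d, [/\ ternary d, expands d z & forall i, (i < n)%N -> d i = u i].
Proof.
move=> tu /andP[lo hi]; have [le1 le2] := tprefix_le R tu (leq0n n).
rewrite /tprefix big_ord0 -/(tprefix R u n) add0r invr1 in le1 le2.
have [zlt|zge] := ltP z (tprefix R u n + 3 ^- n).
  exists (digit 3 z); split; first exact: digit3_lt.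
    by apply: digit3_expands; apply/andP; split; lra.
  by apply: digit3_eq tu _; rewrite lo zlt.
have zE : z = tprefix R u n + 3 ^- n by apply/eqP; rewrite eq_le hi zge.
pose d i := if (i < n)%N then u i else 2%N.
have du i : (i < n)%N -> d i = u i by rewrite /d => ->.
have td : ternary d by move=> i; rewrite /d; case: ifP.
exists d; split => // m.
have cst k : tprefix R d (n + k) + 3 ^- (n + k) = z.
  elim: k => [|k <-]; first by rewrite addn0 zE (eq_tprefix R du).
  by rewrite addnS tprefixS {2}/d ltnNge leq_addr/= (pow3S R (n + k)); ring.
have [nm|/ltnW mn] := leqP n m.
  by rewrite -(cst (m - n)%N) subnKC// lexx lerDl ltW// pow3_gt0.
have [H1 H2] := tprefix_le R td mn; have := cst 0%N; rewrite addn0 => <-.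
by rewrite H2 andbT; apply: le_trans H1 _; rewrite lerDl ltW// pow3_gt0.
Qed.

(** Both points have an expansion that starts with the first [n] digits of the
    left end point. The function is thus Hoelder continuous, its exponent being
    the logarithm of 2 in base 3. *)
Lemma Chat_triadic (p : int) n s :
    p%:~R * 3 ^- n <= s <= p%:~R * 3 ^- n + 3 ^- n ->
  `|Chat s - Chat (p%:~R * 3 ^- n : R)| <= 2 ^- n.
Proof.
set a : R := p%:~R * 3 ^- n => /andP[lo hi]; set k := Num.floor a.
have y01 : 0 <= a - k%:~R < 1.
  have := floor_itv a; rewrite -/k rmorphD/= => /andP[? ?]; apply/andP; lra.
set u := digit 3 (a - k%:~R); have tu := digit3_lt (a - k%:~R).
(* Two integral multiples of [3 ^- n] at distance less than [3 ^- n]. *)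
have yE : a - k%:~R = tprefix R u n.
  have := digit3_expands_lt n y01; rewrite -/u tprefix_numE.
  set N := tprefix_num u n.
  have -> : a - k%:~R = (p - k * 3 ^+ n)%:~R * 3 ^- n.
    by rewrite /a rmorphB rmorphM rmorphXn/= mulrBl mulfK// expf_neq0.
  rewrite -[X in _ < _ + X]mul1r -mulrDl.
  rewrite ler_pM2r ?pow3_gt0// ltr_pM2r ?pow3_gt0//.
  rewrite -[N%:R]/(N%:Z%:~R) -[1]/(1%:~R) -rmorphD/= ler_int ltr_int ltzD1.
  by rewrite -eq_le => /eqP->.
have [|d [td ex du]] := @expands_in_cylinder u n (s - k%:~R) tu.
  by rewrite -yE; apply/andP; split; lra.
rewrite (Chat_expands td ex) (Chat_expands tu (digit3_expands y01)).
exact: Chat_stream_close.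
Qed.

(** Points at distance less than [3 ^- n] lie in the same or in adjacent triadic
    intervals of rank [n], so that three applications of the bound suffice. *)
Lemma triadic_oscillation (f : R -> R) n c :
    (forall (p : int) s, p%:~R * 3 ^- n <= s <= p%:~R * 3 ^- n + 3 ^- n ->
       `|f s - f (p%:~R * 3 ^- n)| <= c) ->
  forall s t, t <= s < t + 3 ^- n -> `|f s - f t| <= 3 * c.
Proof.
move=> H s t /andP[ts st]; have q0 := pow3_gt0 R n.
have cell x : exists p : int, p%:~R * 3 ^- n <= x < p%:~R * 3 ^- n + 3 ^- n.
  exists (Num.floor (x * 3 ^+ n)).
  have := floor_itv (x * 3 ^+ n); rewrite rmorphD/= => /andP[lo hi].
  rewrite ler_pdivrMr ?exprn_gt0// lo/=.
  rewrite -[X in _ < _ + X]mul1r -mulrDl ltr_pdivlMr ?exprn_gt0//.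
have [ps /andP[ps1 ps2]] := cell s; have [pt /andP[pt1 pt2]] := cell t.
have ptps : (pt <= ps)%R.
  rewrite -ltzD1 -(ltr_int R) rmorphD/= -(ltr_pM2r q0) mulrDl mul1r; lra.
have pspt : (ps <= pt + 1)%R.
  rewrite -ltzD1 -(ltr_int R) !rmorphD/= -(ltr_pM2r q0) !mulrDl !mul1r; lra.
have Hs : `|f s - f (ps%:~R * 3 ^- n)| <= c by apply: H; rewrite ps1 ltW.
have Ht : `|f t - f (pt%:~R * 3 ^- n)| <= c by apply: H; rewrite pt1 ltW.
have Hst : `|f (ps%:~R * 3 ^- n) - f (pt%:~R * 3 ^- n)| <= c.
  apply: H; rewrite ler_pM2r// ler_int ptps/=.
  by move: pspt; rewrite -(ler_int R) rmorphD/= -(ler_pM2r q0) mulrDl mul1r.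
rewrite (_ : 3 * c = c + (c + c)); last by ring.
apply: le_trans (ler_distD (f (ps%:~R * 3 ^- n)) _ _) (lerD Hs _).
apply: le_trans (ler_distD (f (pt%:~R * 3 ^- n)) _ _) (lerD Hst _).
by rewrite distrC.
Qed.

Lemma Chat_near s t n : t <= s < t + 3 ^- n ->
  `|Chat s - Chat t| <= 3 * 2 ^- n.
Proof. by apply: triadic_oscillation => p s'; exact: Chat_triadic. Qed.

Lemma pow3_le_pow2 n : 3 ^- n <= 2 ^- n :> R.
Proof. by rewrite lef_pV2 ?posrE ?exprn_gt0// lerXn2r// ?nnegrE ?ler_nat. Qed.

Lemma continuous_Chat : continuous (@Chat R).
Proof.
move=> t; apply/cvgrPdist_lt => eps eps0.
have [|n] := @pow2_small R (eps / 3); first by rewrite divr_gt0.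
rewrite ltr_pdivlMr// mulrC => ne.
apply/nbhs_ballP; exists (3 ^- n); first exact: pow3_gt0.
move=> s; rewrite /ball/= ltr_norml => /andP[lo hi].
have [ts|/ltW st] := leP t s.
  rewrite distrC; apply: le_lt_trans (Chat_near _) ne.
  by rewrite ts/=; lra.
by apply: le_lt_trans (Chat_near _) ne; rewrite st/=; lra.
Qed.

Lemma nowhere_constant_two_values (f : R -> R) :
    (forall t0 eps, 0 < eps -> exists x1 x2,
      [/\ t0 - eps < x1 < t0 + eps, t0 - eps < x2 < t0 + eps & f x1 <> f x2]) ->
  nowhere_constant f.
Proof.
move=> H t0 eps /(H t0)[x1 [x2 [I1 I2 ne]]].
have [e1|/eqP ne1] := eqVneq (f x1) (f t0); last by exists x1.
by exists x2; rewrite // -e1 => e2; apply: ne.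
Qed.

(** In the triadic interval with prefix [u], the streams u1000... and
    u11000... have different values, the second 1 adding one more binary digit;
    so at least one of the two values differs from the value at [t0]. *)
Lemma nowhere_constant_Chat : nowhere_constant (@Chat R).
Proof.
apply: nowhere_constant_two_values => t0 eps eps0;
  have [n ne] := pow2_small eps0.
have {ne} := le_lt_trans (pow3_le_pow2 n) ne; set q := 3 ^- n => qe.
set k := Num.floor t0.
have y01 : 0 <= t0 - k%:~R < 1.
  have := floor_itv t0; rewrite -/k rmorphD/= => /andP[? ?]; apply/andP; lra.
have uy := digit3_expands y01.
set u := digit 3 (t0 - k%:~R) in uy; have tu := digit3_lt (t0 - k%:~R).
have near d : ternary d -> (forall i, (i < n)%N -> d i = u i) ->
    let x := k%:~R + ternary_stream R d in
    t0 - eps < x < t0 + eps /\ Chat x = Chat_stream R d.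
  move=> td du x; have ex := expands_ternary_stream R td; split.
    have := ex n; have := uy n; rewrite -(eq_tprefix R du) -/q /x.
    move=> /andP[? ?] /andP[? ?]; apply/andP; lra.
  by apply: (@Chat_expands _ _ k td); rewrite /x addrAC subrr add0r.
pose d1 i := if (i < n)%N then u i else (i == n)%N : nat.
pose d2 i := if (i < n)%N then u i else (i <= n.+1)%N : nat.
have [||near1 C1] := near d1.
- by move=> i; rewrite /d1; case: ifP => // _; case: eqP.
- by move=> i; rewrite /d1 => ->.
have [||near2 C2] := near d2.
- by move=> i; rewrite /d2; case: ifP => // _; case: (i <= n.+1)%N.
- by move=> i; rewrite /d2 => ->.
exists (k%:~R + ternary_stream R d1), (k%:~R + ternary_stream R d2).
split; [exact: near1|exact: near2|rewrite C1 C2].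
have d1n : d1 n = 1%N by rewrite /d1 ltnn eqxx.
rewrite (@Chat_stream_one_tail _ d1 n 0%N)//; last first.
  by move=> i ni; rewrite /d1 ltnNge ltnW//= gtn_eqF.
rewrite (@Chat_stream_one_tail _ d2 n.+1 0%N)//.
- rewrite (@eq_Chat_partial _ d2 d1) ?Chat_partialS; last first.
    move=> i; rewrite ltnS /d1 /d2 => ni; rewrite leqW// eqn_leq ni andTb.
    by rewrite ltnNge; case: leqP.
  rewrite /Chat_bit d1n mul1r; have := pow2_gt0 R (Chat_exponent d2 n.+1).+1.
  by clear near near1 near2 C1 C2; lra.
- by rewrite /d2 ltnNge leqW ?leqnn.
- by move=> i ni; rewrite /d2 ltnNge (ltnW (ltnW ni))/= leqNgt ni.
Qed.

End Continuity.

(** * Sparsity of the binary digits of the values *)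
Section Normality.
Variable R : realType.
Implicit Types (d : nat -> nat) (x y : R).

Lemma occurrences1 d a n :
  occurrences d [:: a] n = (\sum_(i < n) (d i == a))%N.
Proof.
have E i : occurs_at d [:: a] i = (d i == a).
  apply/forallP/eqP => [/(_ ord0)/=|di [[|//] ?]/=].
    by rewrite addn0 => /eqP.
  by rewrite addn0 di.
rewrite /occurrences -sum1dep_card big_mkcond; apply: eq_bigr => i _.
by rewrite E; case: eqP.
Qed.

(** A crude consequence of normality: a digit of asymptotic frequency [b^-1]
    eventually occurs with a frequency of more than half of that. *)
Lemma normal_frequent b a x : (1 < b)%N -> (a < b)%N -> normal_base b x ->
  exists n0, forall n, (n0 <= n)%N ->
    (n < 2 * b * \sum_(i < n) (digit b x i == a))%N.
Proof.
move=> b1 ab /(_ [:: a]); rewrite /= ab => /(_ isT); rewrite expr1.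
have b0 : 0 < b%:R :> R by rewrite ltr0n ltnW.
move=> /cvgrPdist_lt /(_ (b%:R^-1 / 2)) []; first by rewrite divr_gt0 ?invr_gt0.
move=> n0 _ H; exists n0.+1 => n n0n.
have n_gt0 : 0 < n%:R :> R by rewrite ltr0n (leq_trans _ n0n).
have /= := H n (ltnW n0n); rewrite occurrences1 ltr_norml => /andP[_].
set o := (\sum_(i < n) _)%N => lt_o.
have : b%:R^-1 / 2 < o%:R / n%:R :> R by lra.
rewrite ltr_pdivlMr// -mulrA ltr_pdivrMl// => lt2.
rewrite -(ltr_nat R) !natrM; lra.
Qed.

(** The number of ones among the [N] lowest binary digits of [m]. *)
Fixpoint popcount (N m : nat) : nat :=
  if N is N'.+1 then (odd m + popcount N' m./2)%N else 0%N.

(** Adding a power of 2 turns a run of ones into zeros and creates a single new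
    one. *)
Lemma popcount_addX N a m : (popcount N (2 ^ a + m) <= (popcount N m).+1)%N.
Proof.
elim: N a m => [//|N IH] [|a] m /=.
  rewrite add0n uphalf_half; case: (odd m) => /=; rewrite ?add0n ?add1n//.
  by apply: leqW; have := IH 0%N m./2; rewrite expn0 add1n.
rewrite oddD oddX/= halfD oddX/= add0n expnS mul2n doubleK.
by rewrite -addnS leq_add2l.
Qed.

Lemma popcount_sumX N n (b : nat -> bool) (e : nat -> nat) :
  (popcount N (\sum_(i < n) b i * 2 ^ e i) <= n)%N.
Proof.
elim: n => [|n IH].
  by rewrite big_ord0; elim: N => //= N; rewrite add0n.
rewrite big_ord_recr/=; case: (b n); last by rewrite mul0n addn0 leqW.
by rewrite mul1n addnC; apply: leq_trans (popcount_addX _ _ _) _.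
Qed.

(** The first [N] binary digits of the fractional part of [y] are the [N] lowest
    digits of the integral part of [y * 2 ^+ N]. *)
Lemma sum_digit2 y N : 0 <= y ->
  (\sum_(i < N) (digit 2 y i == 1) = popcount N (Num.truncn (y * 2 ^+ N)))%N.
Proof.
move=> y0; elim: N => [|N IH]; first by rewrite big_ord0.
rewrite big_ord_recr IH /digit ger0_norm//= modn2 eqb1 addnC.
by rewrite -(@truncn_pow_div _ 2 y N 1)// addn1 expn1 divn2.
Qed.

Lemma Chat_exponent_homo d i j : (i < j)%N ->
  (Chat_exponent d i < Chat_exponent d j)%N.
Proof.
move=> /subnKC <-; elim: (j - i.+1)%N => [|k IH];
  first by rewrite addn0 Chat_exponentS.
by rewrite addnS; apply: ltn_trans IH (Chat_exponentS _ _).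
Qed.

Lemma Chat_stream_ge0 d : 0 <= Chat_stream R d.
Proof.
by have := Chat_stream_bounds R d 0; rewrite /Chat_partial big_ord0 => /andP[].
Qed.

(** The first [n] terms add up to a sum of at most [n] powers of 2 on the scale
    [2 ^- Chat_exponent d n], and the tail is at most one unit on that scale.
    Truncating at this rank thus gives a sum of at most [n.+1] powers of 2. *)
Lemma Chat_stream_few_ones d n :
  (\sum_(i < Chat_exponent d n) (digit 2 (Chat_stream R d) i == 1) <= n.+1)%N.
Proof.
set N := Chat_exponent d n; rewrite sum_digit2 ?Chat_stream_ge0//.
(* [A] is the integer [Chat_partial d n * 2 ^+ N]. *)
pose A := (\sum_(i < n) Chat_bit d i * 2 ^ (N - (Chat_exponent d i).+1))%N.
have p0 : 0 < 2 ^+ N :> R by rewrite exprn_gt0.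
have AE : A%:R = Chat_partial R d n * 2 ^+ N.
  rewrite natr_sum mulr_suml; apply: eq_bigr => i _.
  rewrite natrM natrX -mulrA; congr (_ * _).
  have /subnK {2}<- : (Chat_exponent d i < N)%N by exact: Chat_exponent_homo.
  by rewrite exprD mulrCA mulVf ?mulr1// expf_neq0.
have := Chat_stream_bounds R d n; rewrite -/N -(ler_pM2r p0) -AE.
rewrite -[X in _ && X](ler_pM2r p0) mulrDl -AE mulVf ?gt_eqF// => /andP[lo hi].
have popA : (popcount N A <= n)%N.
  pose e i := (N - (Chat_exponent d i).+1)%N.
  exact: (popcount_sumX N n (Chat_bit d) e).
set y := Chat_stream R d * 2 ^+ N in lo hi *.
have [] : Num.truncn y = A \/ Num.truncn y = A.+1.
  have y0 : 0 <= y by rewrite mulr_ge0 ?Chat_stream_ge0// ltW.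
  have : (A <= Num.truncn y)%N by rewrite truncn_ge_nat.
  have : (Num.truncn y < A.+2)%N.
    by rewrite truncn_lt_nat// (le_lt_trans hi)// -natr1 ltrD2r ltr_nat.
  by lia.
- by move=> ->; exact: leqW.
- move=> ->; rewrite -add1n -(expn0 2).
  by apply: leq_trans (popcount_addX _ _ _) _; rewrite ltnS.
Qed.

Lemma ones_before_homo d m n : (m <= n)%N ->
  (ones_before d m <= ones_before d n)%N.
Proof.
move=> /subnKC <-; elim: (n - m)%N => [|k IH]; first by rewrite addn0.
by rewrite addnS ones_beforeS (leq_trans IH)// leq_addr.
Qed.

Lemma ones_before_unbounded d :
  (forall M, exists2 m, (M <= m)%N & d m = 1%N) ->
  forall r, exists n, (r <= ones_before d n)%N.
Proof.
move=> H; elim=> [|r [n rn]]; first by exists 0%N.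
have [m nm dm] := H n; exists m.+1; rewrite ones_beforeS dm addn1 ltnS.
exact: leq_trans rn (ones_before_homo _ nm).
Qed.

(** Just after the [r]-th digit 1, at position [n], the exponent is [r.+1 * n],
    whereas only [n.+1] binary digits up to there can be 1: the frequency of
    ones tends to 0 along these ranks instead of being 1/2. *)
Lemma Chat_stream_not_normal d :
  (forall M, exists2 m, (M <= m)%N & d m = 1%N) ->
    ~ normal_base 2 (Chat_stream R d).
Proof.
move=> H /(@normal_frequent 2 1) [//|//|n0 freq].
(* At most [n.+1 <= 2 * n] of [r.+1 * n] digits are ones: for [r >= 8] this is
   less than a quarter of them. *)
have [n1 n1P] := ones_before_unbounded H 8.
have [m] := H (maxn n0 n1); rewrite geq_max => /andP[n0m n1m] dm.
have r8 := leq_trans n1P (ones_before_homo d (leqW n1m)).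
have NE : Chat_exponent d m.+1 = (ones_before d m.+1 * m.+1 + m.+1)%N.
  by rewrite /Chat_exponent block_startS dm.
have := freq (Chat_exponent d m.+1); have := Chat_stream_few_ones d m.+1.
set o := (\sum_(i < _) _)%N; rewrite NE; move: (ones_before d m.+1) r8 => r r8.
move=> om /(_ _); have : (n0 <= r * m.+1 + m.+1)%N by lia.
by move=> -> /(_ isT); nia.
Qed.

Lemma normal_ones x : normal_base 3 x ->
  forall M, exists2 m, (M <= m)%N & digit 3 x m = 1%N.
Proof.
move=> /(@normal_frequent 3 1) [//|//|n0 freq] M; apply: contrapT => noM.
have few n : (\sum_(i < n) (digit 3 x i == 1) <= M)%N.
  elim: n => [|n IH]; first by rewrite big_ord0.
  have [nM|Mn] := ltnP n M.
    by apply: (@leq_trans n.+1) => //;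
      rewrite -[leqRHS]card_ord -sum1_card leq_sum// => i _; case: eqP.
  rewrite big_ord_recr/=; case: eqP => [dn|_]; last by rewrite addn0.
  by exfalso; apply: noM; exists n.
have := freq (n0 + 6 * M)%N (leq_addr _ _); have := few (n0 + 6 * M)%N.
by move: (\sum_(i < _) _)%N => o; lia.
Qed.

(** For negative [x], the fractional part is complementary to that of [`|x|];
    complementing ternary digits exchanges 0 and 2 and keeps the digits 1. *)
Lemma fracpart_ones x : (forall M, exists2 m, (M <= m)%N & digit 3 x m = 1%N) ->
  forall M, exists2 m, (M <= m)%N & digit 3 (x - (Num.floor x)%:~R) m = 1%N.
Proof.
move=> H M; have [m Mm dm] := H M; exists m => //.
have := floor_itv x; set k := Num.floor x; rewrite rmorphD/= => /andP[k1 k2].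
have y0 : 0 <= x - k%:~R by rewrite subr_ge0.
set p : R := 3 ^+ m.+1; have p0 : 0 < p by rewrite exprn_gt0.
have px : 0 <= `|x| * p by rewrite mulr_ge0// ltW.
have pE : p = (3 ^ m.+1)%:R by rewrite natrX.
move: dm; rewrite /digit (ger0_norm y0) -/p.
have /andP[] := truncn_itv px; set T := Num.truncn _ => lo hi dT.
have p3 : (3 ^ m.+1 = 3 * 3 ^ m)%N by rewrite expnS.
have kE : k%:~R = (if 0 <= k then 1 else -1) * `|k|%N%:R :> R.
  by case: k {k1 k2 y0} => n; rewrite ?mul1r// NegzE mulN1r rmorphN.
move: kE; rewrite floor_ge0; set z := `|k|%N; case: leP => x0 kE.
  rewrite ger0_norm// in lo hi.
  have zT : (z * 3 ^ m.+1 <= T)%N.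
    by rewrite truncn_ge_nat// ger0_norm// natrM -pE ler_pM2r//; lra.
  have -> : Num.truncn ((x - k%:~R) * p) = (T - z * 3 ^ m.+1)%N.
    apply: truncn_def; rewrite -subSn// !natrB ?leqW// natrM -pE kE; lra.
  by move: zT dT; rewrite p3 => zT dT; clearbody T z; clear -zT dT; lia.
rewrite ltr0_norm// in lo hi.
(* If [`|x| * p] is an integer, then the digits of [x] vanish from [m.+1] on. *)
have [noint|int] : (T%:R < - x * p) \/ - x * p = T%:R.
  by move: lo; rewrite le_eqVlt => /orP[/eqP|]; [right|left].
  have Tz : (T < z * 3 ^ m.+1)%N.
    rewrite -(ltr_nat R) natrM -pE; apply: lt_le_trans noint _.
    by rewrite ler_pM2r//; lra.
  have -> : Num.truncn ((x - k%:~R) * p) = (z * 3 ^ m.+1 - T.+1)%N.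
    apply: truncn_def; rewrite -subSn// subSS !natrB ?(ltnW Tz)// natrM -pE kE.
    by rewrite -[T.+1%:R]natr1 in hi *; apply/andP; split; lra.
  by move: Tz dT; rewrite p3 => Tz dT; clearbody T z; clear -Tz dT; lia.
have [m' mm'] := H m.+1; rewrite /digit ltr0_norm// -(subnKC mm') -addnS exprD.
by rewrite -/p mulrA int -natrX -natrM natrK expnS mulnCA modnMr.
Qed.

End Normality.

Theorem theorem1p6 (R : realType) :
  [/\ continuous (@Chat R),
      nowhere_constant (@Chat R)
    & (@Chat R @` normal_numbers) `&` normal_numbers = set0].
Proof.
split; [exact: continuous_Chat|exact: nowhere_constant_Chat|].
apply/seteqP; split=> // _ [[x Nx <-] /(_ 2%N isT)].
have y01 : 0 <= x - (Num.floor x)%:~R < 1.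
  by have := floor_itv x; rewrite rmorphD/= => /andP[? ?]; apply/andP; lra.
rewrite /Chat Chat_unitE//; apply: Chat_stream_not_normal.
exact/fracpart_ones/normal_ones/Nx.
Qed.
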